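(* Consider the $D_4^{(1)}$ system (defined in the context) restricted to parameters with $\alpha_4=\alpha_3=\alpha_0=\alpha_1$, and set $\beta_0:=\alpha_2$, $\beta_1:=\alpha_1$, so that $\beta_0+2\beta_1=\frac12$. This system admits the affine Weyl group symmetry of type $A_2^{(2)}$ as the group of its Bäcklund transformations, whose generators are explicitly given as follows, with the notation $( * ):=(x,y,z;\beta_0,\beta_1)$: $$\begin{aligned} s_0:( * )&\rightarrow\left(x+\tfrac{\beta_0}{z},y+\tfrac{\beta_0}{z},z;-\beta_0,\beta_1+\beta_0\right),\\ s_1:( * )&\rightarrow\left(x,y,z-\tfrac{\beta_1\{y(x-\eta)(y-1)+x(x-\eta)(y-1)+xy(y-1)+xy(x-\eta)\}}{xy(x-\eta)(y-1)};\beta_0+4\beta_1,-\beta_1\right). \end{aligned}$$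
   Context: A Bäcklund transformation of a parametrized system is a birational transformation of the variables and parameters that takes the system with the original parameters to the system of the same form with the transformed parameters (here $\eta$ and $b(t)$ are unchanged). Affine Weyl group symmetry of type $A_2^{(2)}$ means that each $s_i$ is a Bäcklund transformation and that the $s_i$ satisfy the fundamental relations of the affine Weyl group of type $A_2^{(2)}$: $s_0^2=s_1^2=1$ (and no relation between $s_0$ and $s_1$). The $D_4^{(1)}$ system. Let $\eta\in\mathbb{C}\setminus\{0\}$, let $b(t)\in\mathbb{C}(t)$ be nonzero, and let $\alpha_0,\dots,\alpha_4\in\mathbb{C}$ satisfy $\alpha_0+\alpha_1+2\alpha_2+\alpha_3+\alpha_4=1$. The $D_4^{(1)}$ system for unknown functions $x,y,z$ of $t$ is $$\frac{2\eta}{b(t)}\frac{dx}{dt}=P,\qquad -\frac{2\eta}{b(t)}\frac{dy}{dt}=Q,\qquad \frac{2\eta}{b(t)}\frac{dz}{dt}=R,$$ where $P=-2x(y-1)yz(x-\eta)(2x-2y+1-\eta)-2(2\alpha_0+2\alpha_1+4\alpha_2+\alpha_3+\alpha_4)x^3y-2(\alpha_0+\alpha_1)xy^3+(5\alpha_0+5\alpha_1+6\alpha_2+\alpha_3+\alpha_4)x^2y^2-\{5\alpha_0+5\alpha_1+6\alpha_2+2\alpha_3-3(2\alpha_0+2\alpha_1+4\alpha_2+\alpha_3+\alpha_4)\eta\}x^2y+\{3(\alpha_0+\alpha_1)-(4\alpha_0+6\alpha_1+6\alpha_2+\alpha_3+\alpha_4)\eta\}xy^2+x^4+2(\alpha_0+\alpha_1+2\alpha_2+\alpha_3-\eta)x^3+2\alpha_1\eta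 y^3+\{(\alpha_0+\alpha_1+2\alpha_2+\alpha_3)(\eta^2-3\eta+1)+\alpha_4\eta^2\}x^2+\alpha_1(\eta-3)\eta y^2+\{-(\alpha_0+\alpha_1)+2(2\alpha_0+3\alpha_1+3\alpha_2+\alpha_3)\eta-(2\alpha_0+2\alpha_1+4\alpha_2+\alpha_3+\alpha_4)\eta^2\}xy+(\alpha_0+\alpha_1+2\alpha_2+\alpha_3)(\eta-1)\eta x-\alpha_1(\eta-1)\eta y$, $Q=2x(y-1)yz(x-\eta)(2x-2y+1-\eta)-2(\alpha_3+\alpha_4)x^3y-2(\alpha_0+\alpha_1+4\alpha_2+2\alpha_3+2\alpha_4)xy^3+(\alpha_0+\alpha_1+6\alpha_2+5\alpha_3+5\alpha_4)x^2y^2+\{-(\alpha_0+\alpha_1+6\alpha_2+4\alpha_3+6\alpha_4)+3(\alpha_3+\alpha_4)\eta\}x^2y+\{3(\alpha_0+\alpha_1+4\alpha_2+2\alpha_3+2\alpha_4)-(2\alpha_0+6\alpha_2+5\alpha_3+5\alpha_4)\eta\}xy^2+y^4+2\alpha_4x^3+2\{(\alpha_0+2\alpha_2+\alpha_3+\alpha_4)\eta-1\}y^3-\alpha_4(3\eta-1)x^2+\{1-3(\alpha_0+2\alpha_2+\alpha_3+\alpha_4)\eta+(\alpha_0+2\alpha_2+\alpha_3+\alpha_4)\eta^2\}y^2+\{-(\alpha_0+\alpha_1+4\alpha_2+2\alpha_3+2\alpha_4)+2(\alpha_0+3\alpha_2+2\alpha_3+3\alpha_4)\eta-(\alpha_3+\alpha_4)\eta^2\}xy+\alpha_4(\eta-1)\eta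 x-(\alpha_0+2\alpha_2+\alpha_3+\alpha_4)(\eta-1)\eta y$, $R=(2x-2y+1-\eta)\{2x^2y+2xy^2-x^2-\eta y^2-2(\eta+1)xy+\eta(x+y)\}z^2+z\big[-2(\alpha_3+\alpha_4)x^3+2(\alpha_0+\alpha_1)y^3+2(\alpha_0+\alpha_1+6\alpha_2+2\alpha_3+2\alpha_4)x^2y-2(2\alpha_0+2\alpha_1+6\alpha_2+\alpha_3+\alpha_4)xy^2+\{-(\alpha_0+\alpha_1+6\alpha_2+4\alpha_3)+3(\alpha_3+\alpha_4)\eta\}x^2+\{-3(\alpha_0+\alpha_1)+(4\alpha_0+6\alpha_2+\alpha_3+\alpha_4)\eta\}y^2-4\{-(\alpha_0+\alpha_1+3\alpha_2+\alpha_3)+(\alpha_0+3\alpha_2+\alpha_3+\alpha_4)\eta\}xy+\{-(\alpha_0+\alpha_1+4\alpha_2+2\alpha_3)+2(\alpha_0+3\alpha_2+2\alpha_3)\eta-(\alpha_3+\alpha_4)\eta^2\}x+\{\alpha_0+\alpha_1-2(2\alpha_0+3\alpha_2+\alpha_3)\eta+(2\alpha_0+4\alpha_2+\alpha_3+\alpha_4)\eta^2\}y-(\alpha_0+2\alpha_2+\alpha_3)(\eta-1)\eta\big]+\alpha_2\big[(\alpha_0+\alpha_1+2\alpha_2-\alpha_3-\alpha_4)x^2+(\alpha_0+\alpha_1-2\alpha_2-\alpha_3-\alpha_4)y^2-2(\alpha_0+\alpha_1-\alpha_3-\alpha_4)xy+\{\alpha_0+\alpha_1-2\alpha_3-(2\alpha_0+2\alpha_2-\alpha_3-\alpha_4)\eta\}x+\{-\alpha_0-\alpha_1+2\alpha_2+2\alpha_3+(2\alpha_0-\alpha_3-\alpha_4)\eta\}y+(\eta-1)(\alpha_2+\alpha_3+(\alpha_0+\alpha_2)\eta)\big]$.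 *)

(* Defs.v *)
From HB Require Import structures.
From mathcomp Require Import all_boot all_order all_algebra.
From mathcomp Require Import generic_quotient fraction.
From mathcomp Require Import mpoly.
From mathcomp Require Import reals.
From mathcomp Require Import complex.

Set Implicit Arguments.
Unset Strict Implicit.
Unset Printing Implicit Defensive.

Import GRing.Theory.
Local Open Scope ring_scope.
Local Open Scope quotient_scope.

Local Notation "x %:F" := (@FracField.tofrac _ x) : ring_scope.

Definition d4P (L : comNzRingType) (eta a0 a1 a2 a3 a4 x y z : L) : L :=
  - 2 * x * (y - 1) * y * z * (x - eta) * (2 * x - 2 * y + 1 - eta)
  - 2 * (2 * a0 + 2 * a1 + 4 * a2 + a3 + a4) * x ^+ 3 * y
  - 2 * (a0 + a1) * x * y ^+ 3
  + (5 * a0 + 5 * a1 + 6 * a2 + a3 + a4) * x ^+ 2 * y ^+ 2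
  - (5 * a0 + 5 * a1 + 6 * a2 + 2 * a3
     - 3 * (2 * a0 + 2 * a1 + 4 * a2 + a3 + a4) * eta) * x ^+ 2 * y
  + (3 * (a0 + a1) - (4 * a0 + 6 * a1 + 6 * a2 + a3 + a4) * eta) * x * y ^+ 2
  + x ^+ 4
  + 2 * (a0 + a1 + 2 * a2 + a3 - eta) * x ^+ 3
  + 2 * a1 * eta * y ^+ 3
  + ((a0 + a1 + 2 * a2 + a3) * (eta ^+ 2 - 3 * eta + 1) + a4 * eta ^+ 2)
    * x ^+ 2
  + a1 * (eta - 3) * eta * y ^+ 2
  + (- (a0 + a1) + 2 * (2 * a0 + 3 * a1 + 3 * a2 + a3) * eta
     - (2 * a0 + 2 * a1 + 4 * a2 + a3 + a4) * eta ^+ 2) * x * y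
  + (a0 + a1 + 2 * a2 + a3) * (eta - 1) * eta * x
  - a1 * (eta - 1) * eta * y.

Definition d4Q (L : comNzRingType) (eta a0 a1 a2 a3 a4 x y z : L) : L :=
  2 * x * (y - 1) * y * z * (x - eta) * (2 * x - 2 * y + 1 - eta)
  - 2 * (a3 + a4) * x ^+ 3 * y
  - 2 * (a0 + a1 + 4 * a2 + 2 * a3 + 2 * a4) * x * y ^+ 3
  + (a0 + a1 + 6 * a2 + 5 * a3 + 5 * a4) * x ^+ 2 * y ^+ 2
  + (- (a0 + a1 + 6 * a2 + 4 * a3 + 6 * a4) + 3 * (a3 + a4) * eta)
    * x ^+ 2 * y
  + (3 * (a0 + a1 + 4 * a2 + 2 * a3 + 2 * a4)
     - (2 * a0 + 6 * a2 + 5 * a3 + 5 * a4) * eta) * x * y ^+ 2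
  + y ^+ 4
  + 2 * a4 * x ^+ 3
  + 2 * ((a0 + 2 * a2 + a3 + a4) * eta - 1) * y ^+ 3
  - a4 * (3 * eta - 1) * x ^+ 2
  + (1 - 3 * (a0 + 2 * a2 + a3 + a4) * eta
     + (a0 + 2 * a2 + a3 + a4) * eta ^+ 2) * y ^+ 2
  + (- (a0 + a1 + 4 * a2 + 2 * a3 + 2 * a4)
     + 2 * (a0 + 3 * a2 + 2 * a3 + 3 * a4) * eta
     - (a3 + a4) * eta ^+ 2) * x * y
  + a4 * (eta - 1) * eta * x
  - (a0 + 2 * a2 + a3 + a4) * (eta - 1) * eta * y.

Definition d4R (L : comNzRingType) (eta a0 a1 a2 a3 a4 x y z : L) : L :=
  (2 * x - 2 * y + 1 - eta)
  * (2 * x ^+ 2 * y + 2 * x * y ^+ 2 - x ^+ 2 - eta * y ^+ 2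
     - 2 * (eta + 1) * x * y + eta * (x + y)) * z ^+ 2
  + z * (- 2 * (a3 + a4) * x ^+ 3
         + 2 * (a0 + a1) * y ^+ 3
         + 2 * (a0 + a1 + 6 * a2 + 2 * a3 + 2 * a4) * x ^+ 2 * y
         - 2 * (2 * a0 + 2 * a1 + 6 * a2 + a3 + a4) * x * y ^+ 2
         + (- (a0 + a1 + 6 * a2 + 4 * a3) + 3 * (a3 + a4) * eta) * x ^+ 2
         + (- 3 * (a0 + a1) + (4 * a0 + 6 * a2 + a3 + a4) * eta) * y ^+ 2
         - 4 * (- (a0 + a1 + 3 * a2 + a3) + (a0 + 3 * a2 + a3 + a4) * eta)
           * x * y
         + (- (a0 + a1 + 4 * a2 + 2 * a3)
            + 2 * (a0 + 3 * a2 + 2 * a3) * eta - (a3 + a4) * eta ^+ 2) * x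
         + (a0 + a1 - 2 * (2 * a0 + 3 * a2 + a3) * eta
            + (2 * a0 + 4 * a2 + a3 + a4) * eta ^+ 2) * y
         - (a0 + 2 * a2 + a3) * (eta - 1) * eta)
  + a2 * ((a0 + a1 + 2 * a2 - a3 - a4) * x ^+ 2
          + (a0 + a1 - 2 * a2 - a3 - a4) * y ^+ 2
          - 2 * (a0 + a1 - a3 - a4) * x * y
          + (a0 + a1 - 2 * a3 - (2 * a0 + 2 * a2 - a3 - a4) * eta) * x
          + (- a0 - a1 + 2 * a2 + 2 * a3 + (2 * a0 - a3 - a4) * eta) * y
          + (eta - 1) * (a2 + a3 + (a0 + a2) * eta)).

(** The [D_4^(1)] system, including the normalization of its parameters; the
    derivation [D] of the field [L] plays the role of [d/dt]. *)
Definition d4_system (L : fieldType) (D : L -> L)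
    (eta b a0 a1 a2 a3 a4 x y z : L) : Prop :=
  a0 + a1 + 2 * a2 + a3 + a4 = 1 /\
  [/\ 2 * eta / b * D x = d4P eta a0 a1 a2 a3 a4 x y z,
      - (2 * eta / b) * D y = d4Q eta a0 a1 a2 a3 a4 x y z
    & 2 * eta / b * D z = d4R eta a0 a1 a2 a3 a4 x y z].

(** A point [(x, y, z; beta0, beta1)] with coordinates in [L]. *)
Definition point (L : Type) : Type := (L * L * L * (L * L))%type.

Definition map_point (L L' : Type) (f : L -> L') (p : point L) : point L' :=
  let: (x, y, z, (be0, be1)) := p in (f x, f y, f z, (f be0, f be1)).

Definition a22_system (L : fieldType) (D : L -> L) (eta b : L) (p : point L)
    : Prop :=
  let: (x, y, z, (be0, be1)) := p in
  d4_system D eta b be1 be1 be0 be1 be1 x y z.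

Definition a22_s0 (L : fieldType) (p : point L) : point L :=
  let: (x, y, z, (be0, be1)) := p in
  (x + be0 / z, y + be0 / z, z, (- be0, be1 + be0)).

Definition a22_s1 (L : fieldType) (eta : L) (p : point L) : point L :=
  let: (x, y, z, (be0, be1)) := p in
  (x, y,
   z - be1 * (y * (x - eta) * (y - 1) + x * (x - eta) * (y - 1)
              + x * y * (y - 1) + x * y * (x - eta))
       / (x * y * (x - eta) * (y - 1)),
   (be0 + 4 * be1, - be1)).

Definition derivation (L : nzRingType) (D : L -> L) : Prop :=
  (forall f g, D (f + g) = D f + D g) /\
  (forall f g, D (f * g) = D f * g + f * D g).

(** Quotient rule.  It is applied to the representative of [f] picked by [repr];
    when [d] is a derivation, the value does not depend on that choice. *)
Definition frac_deriv (A : idomainType) (d : A -> {fraction A})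
    (f : {fraction A}) : {fraction A} :=
  let n := \n_(repr f) in let m := \d_(repr f) in
  (d n * m%:F - n%:F * d m) / m%:F ^+ 2.

Section FunctionField.
Variable R : realType.

(** The field [C(t)]. *)
Definition ratfun : fieldType := {fraction {poly R[i]}}.

Definition cst (c : R[i]) : ratfun := (c%:P)%:F.

Definition ddt : ratfun -> ratfun :=
  frac_deriv (fun p : {poly R[i]} => (p^`())%:F).

(** [C(t)(x, y, z, beta1)]; as [beta0 + 2 beta1 = 1/2], it is the function field
    over [C(t)] of the space of the variables and parameters. *)
Definition Kfield : fieldType := {fraction {mpoly ratfun[4]}}.

Definition emb (f : ratfun) : Kfield := (f%:MP_[4])%:F.

Definition coord (k : 'I_4) : Kfield := ('X_k)%:F.

Definition gx := coord (@Ordinal 4 0 isT).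
Definition gy := coord (@Ordinal 4 1 isT).
Definition gz := coord (@Ordinal 4 2 isT).
Definition gbe1 := coord (@Ordinal 4 3 isT).
Definition gbe0 : Kfield := 1 / 2 - 2 * gbe1.

Definition generic_point : point Kfield := (gx, gy, gz, (gbe0, gbe1)).

Variables (eta : R[i]) (b : ratfun).

(** Time derivatives of [x, y, z, beta1] prescribed by the system. *)
Definition a22_velocity (k : 'I_4) : Kfield :=
  let e := emb (cst eta) in
  let c := emb b / (2 * e) in
  nth 0 [:: c * d4P e gbe1 gbe1 gbe0 gbe1 gbe1 gx gy gz;
            - c * d4Q e gbe1 gbe1 gbe0 gbe1 gbe1 gx gy gz;
            c * d4R e gbe1 gbe1 gbe0 gbe1 gbe1 gx gy gz; 0] k.

(** Derivation of [Kfield] along the system: it extends [d/dt] on [C(t)] and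
    takes the values [a22_velocity] on [x, y, z, beta1]. *)
Definition a22_deriv : Kfield -> Kfield :=
  frac_deriv (fun p : {mpoly ratfun[4]} =>
    (\sum_(m <- msupp p) ddt p@_m *: 'X_[m])%:F
    + \sum_(k < 4) (p^`M(k))%:F * a22_velocity k).

(** A birational transformation of the variables and parameters is an
    automorphism [s] of the function field over [C(t)].  It sends the point
    [(x, y, z; beta0, beta1)], which is the generic solution of the system, to
    [(s x, s y, s z; s beta0, s beta1)]; the latter must solve the system whose
    (constant) parameters are [s beta0] and [s beta1]. *)
Definition backlund (s : {rmorphism Kfield -> Kfield}) : Prop :=
  [/\ bijective s,
      forall f : ratfun, s (emb f) = emb f,
      a22_deriv (s gbe0) = 0 /\ a22_deriv (s gbe1) = 0
    & a22_system a22_deriv (emb (cst eta)) (emb b) (map_point s generic_point)].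

End FunctionField.

Definition word_action (T : Type) (s0 s1 : T -> T) (w : seq bool) : T -> T :=
  foldr (fun c f => (if c then s1 else s0) \o f) id w.

(** [s0] and [s1] satisfy [s0^2 = s1^2 = 1] and no further relation: no nonempty
    alternating word in them is trivial. *)
Definition weylA22 (T : Type) (s0 s1 : T -> T) : Prop :=
  [/\ s0 \o s0 =1 id, s1 \o s1 =1 id
    & forall w : seq bool, w <> [::] -> sorted (fun c c' => c != c') w ->
        ~ (word_action s0 s1 w =1 id)].

(* Main.v *)
Require Import Defs.
From HB Require Import structures.
From mathcomp Require Import all_boot all_order all_algebra.
From mathcomp Require Import generic_quotient fraction mpoly.
From mathcomp Require Import reals.
From mathcomp Require Import complex.
From mathcomp Require Import ring.

Set Implicit Arguments.
Unset Strict Implicit.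
Unset Printing Implicit Defensive.

Import GRing.Theory.
Local Open Scope ring_scope.

(** The heart of the proof is algebraic.  Write [k = 2 eta / b], so that a
    solution satisfies [k x' = P], [k y' = - Q], [k z' = R].  For [s0], put
    [u = beta0 / z]; as [beta0] is constant, [k u' = - u R / z], and the
    transformed equations reduce to polynomial identities between [P], [Q] and
    [R] at [(x + u, y + u, z)] and at [(x, y, z)], once [beta0] is replaced by
    [u z] ([d4P_shift], [d4Q_shift], [d4R_shift]).  For [s1], the quantity
    subtracted from [z] is [beta1] times
    [1/x + 1/(x - eta) + 1/y + 1/(y - 1)].  The change of parameters exactly
    compensates this translation of [z] in [P] and [Q] ([d4PQ_shear]), and makes
    [R] vary by the derivative of the translation ([d4R_shear]).  These
    computations hold in every differential field in which the parameters are
    constants ([a22_system_s0], [a22_system_s1]), hence for the solutions with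
    complex parameters.

    The birational statement is the same computation at the generic point of
    [C(t)(x, y, z, beta1)].  Two facts make it available there.  First,
    [a22_deriv] is a derivation: the quotient rule turns any derivation from a
    domain to its fraction field into a derivation of that field
    ([frac_deriv_derivation]).  Secondly, the substitutions [s0] and [s1] of
    polynomials extend to the field of fractions, that is, no nonzero polynomial
    vanishes at the transformed point: the substitutions undo themselves, so
    they lose nothing ([selfinv_eq0], [involution_ext]), which also gives
    [s0^2 = s1^2 = 1].

    Finally, [s0] and [s1] act on [beta1] as the reflections
    [beta1 |-> 1/2 - beta1] and [beta1 |-> - beta1] of a line, whose product is
    a nontrivial translation, of infinite order in characteristic 0.  They
    therefore generate an infinite dihedral group, the affine Weyl group of type
    [A_2^(2)] ([weylA22_of_reflections]). *)

Local Notation "x %:F" := (@FracField.tofrac _ x) : ring_scope.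

(** * Derivations of a field *)

Section Derivation.
Variables (L : fieldType) (D : L -> L).
Hypothesis derD : derivation D.

Lemma derivationD f g : D (f + g) = D f + D g.
Proof. by case: derD. Qed.

Lemma derivationM f g : D (f * g) = D f * g + f * D g.
Proof. by case: derD. Qed.

Lemma derivation0 : D 0 = 0.
Proof. by apply: (addrI (D 0)); rewrite -derivationD !addr0. Qed.

Lemma derivation1 : D 1 = 0.
Proof.
by apply: (addrI (D 1)); rewrite -{3}[1]mulr1 derivationM mulr1 mul1r addr0.
Qed.

Lemma derivationN f : D (- f) = - D f.
Proof. by apply/eqP; rewrite -addr_eq0 -derivationD addNr derivation0. Qed.

Lemma derivationB f g : D (f - g) = D f - D g.
Proof. by rewrite derivationD derivationN. Qed.

Lemma derivation_nat n : D n%:R = 0.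
Proof.
elim: n => [|n IHn]; first exact: derivation0.
by rewrite -natr1 derivationD IHn derivation1 addr0.
Qed.

Lemma derivationV f : f != 0 -> D f^-1 = - (D f / f ^+ 2).
Proof.
move=> f0; apply: (mulfI f0); apply/(addrI (D f * f^-1)).
by rewrite -derivationM divff // derivation1; field.
Qed.

Lemma derivation_div f g : g != 0 -> D (f / g) = D f / g - f * D g / g ^+ 2.
Proof. by move=> g0; rewrite derivationM derivationV // mulrN mulrA. Qed.

End Derivation.

(** * Extension of derivations and morphisms to fractions *)

Section QuotientRule.
Variable L : fieldType.
Implicit Types a c n m : L.

(** The quotient rule does not depend on the fraction: when [n / m = a / c],
    differentiating [n c = a m] yields [dn] in terms of the other data. *)
Lemma quotient_rule_eq a c n m da dc dn dm : c != 0 -> m != 0 ->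
  n * c = a * m -> dn * c + n * dc = da * m + a * dm ->
  (dn * m - n * dm) / m ^+ 2 = (da * c - a * dc) / c ^+ 2.
Proof.
move=> c0 m0 E dE.
have -> : dn = (da * m + a * dm - n * dc) / c by rewrite -dE addrK mulfK.
have -> : n = a * m / c by rewrite -E mulfK.
by field; rewrite c0 m0.
Qed.

Lemma quotient_ruleD a c a' c' da dc da' dc' : c != 0 -> c' != 0 ->
  ((da * c' + a * dc' + (da' * c + a' * dc)) * (c * c')
     - (a * c' + a' * c) * (dc * c' + c * dc')) / (c * c') ^+ 2
  = (da * c - a * dc) / c ^+ 2 + (da' * c' - a' * dc') / c' ^+ 2.
Proof. by move=> c0 c0'; field; rewrite c0 c0'. Qed.

Lemma quotient_ruleM a c a' c' da dc da' dc' : c != 0 -> c' != 0 ->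
  ((da * a' + a * da') * (c * c') - a * a' * (dc * c' + c * dc'))
    / (c * c') ^+ 2
  = (da * c - a * dc) / c ^+ 2 * (a' / c')
    + a / c * ((da' * c' - a' * dc') / c' ^+ 2).
Proof. by move=> c0 c0'; field; rewrite c0 c0'. Qed.

End QuotientRule.

Section FractionField.
Variable A : idomainType.
Implicit Types (a c : A) (f g : {fraction A}).

(** Fractions are classes of pairs, and [frac_deriv] reads off a representative;
    this equation and [frac_eqE] translate representatives into quotients. *)
Lemma fracE f : f = (\n_(repr f))%:F / (\d_(repr f))%:F.
Proof.
have d0 := denom_ratioP (repr f).
apply: (mulIf (_ : (\d_(repr f))%:F != 0)); rewrite ?tofrac_eq0 //.
rewrite divfK ?tofrac_eq0 //.
rewrite -{1}[f]reprK; unlock FracField.tofrac.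
rewrite -[LHS]FracField.pi_mul; apply/eqmodP; rewrite /= FracField.equivfE.
by rewrite /FracField.mulf !numden_Ratio ?mulr1 ?oner_eq0 // mulrC.
Qed.

Lemma frac_ind (P : {fraction A} -> Prop) :
  (forall a c, c != 0 -> P (a%:F / c%:F)) -> forall f, P f.
Proof. by move=> Pdiv f; rewrite [f]fracE; apply/Pdiv/denom_ratioP. Qed.

Lemma frac_eqE a c a' c' : c != 0 -> c' != 0 ->
  a%:F / c%:F = a'%:F / c'%:F -> a * c' = a' * c.
Proof.
move=> c0 c0' /eqP; rewrite eqr_div ?tofrac_eq0 // -!rmorphM tofrac_eq.
by move/eqP.
Qed.

Section FracDeriv.
Variable d : A -> {fraction A}.
Hypothesis dD : forall a c, d (a + c) = d a + d c.
Hypothesis dM : forall a c, d (a * c) = d a * c%:F + a%:F * d c.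

Lemma frac_deriv_div a c : c != 0 ->
  frac_deriv d (a%:F / c%:F) = (d a * c%:F - a%:F * d c) / c%:F ^+ 2.
Proof.
move=> c0; rewrite /frac_deriv /=; set r := repr _.
have m0 : \d_r != 0 := denom_ratioP r.
have E := esym (frac_eqE c0 m0 (fracE _)); rewrite -/r in E.
apply: quotient_rule_eq; rewrite ?tofrac_eq0 // -?dM -?rmorphM E //.
Qed.

Lemma frac_deriv_tofrac a : frac_deriv d a%:F = d a.
Proof.
have d1 : d 1 = 0.
  by apply: (addrI (d 1)); rewrite -{3}[1]mulr1 dM rmorph1 mulr1 mul1r addr0.
rewrite -[a%:F]divr1 -(rmorph1 (@FracField.tofrac A)) frac_deriv_div ?oner_eq0 //.
by rewrite d1 rmorph1 expr1n divr1 mulr1 mulr0 subr0.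
Qed.

Lemma frac_deriv_derivation : derivation (frac_deriv d).
Proof.
split; elim/frac_ind=> a c c0; elim/frac_ind=> a' c' c0';
  have F0 : c%:F != 0 by [rewrite tofrac_eq0];
  have F0' : c'%:F != 0 by [rewrite tofrac_eq0].
- rewrite addf_div // -!rmorphM -rmorphD !frac_deriv_div ?mulf_neq0 //.
  by rewrite dD !dM rmorphD !rmorphM quotient_ruleD.
rewrite mulf_div -!rmorphM !frac_deriv_div ?mulf_neq0 //.
by rewrite !dM !rmorphM quotient_ruleM.
Qed.

End FracDeriv.

(** Universal property of the field of fractions: an injective morphism to a
    field sends every denominator to a unit. *)
Lemma frac_rmorph_ext (K : fieldType) (phi : {rmorphism A -> K}) :
  (forall a, phi a = 0 -> a = 0) ->
  exists S : {rmorphism {fraction A} -> K}, forall a, S a%:F = phi a.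
Proof.
move=> phi_inj.
have phi0 a : a != 0 -> phi a != 0.
  by apply: contra_neq; apply: phi_inj.
pose S f := phi (\n_(repr f)) / phi (\d_(repr f)).
have SE a c : c != 0 -> S (a%:F / c%:F) = phi a / phi c.
  move=> c0; rewrite /S; set r := repr _.
  have m0 : \d_r != 0 := denom_ratioP r.
  have E := esym (frac_eqE c0 m0 (fracE _)); rewrite -/r in E.
  by apply/eqP; rewrite eqr_div ?phi0 // -!rmorphM E.
have S_tofrac a : S a%:F = phi a.
  rewrite -[a%:F]divr1 -(rmorph1 (@FracField.tofrac A)) SE ?oner_eq0 //.
  by rewrite rmorph1 divr1.
have SB : zmod_morphism S.
  elim/frac_ind=> a c c0; elim/frac_ind=> a' c' c0'.
  rewrite -mulNr addf_div ?tofrac_eq0 // -rmorphN -!rmorphM -rmorphD.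
  rewrite !SE ?mulf_neq0 // rmorphD !rmorphM rmorphN -mulNr.
  by rewrite [RHS]addf_div ?phi0.
have SM : monoid_morphism S.
  split; first by rewrite -(rmorph1 (@FracField.tofrac A)) S_tofrac rmorph1.
  elim/frac_ind=> a c c0; elim/frac_ind=> a' c' c0'.
  by rewrite mulf_div -!rmorphM !SE ?mulf_neq0 // !rmorphM mulf_div.
by exists (HB.pack_for {rmorphism {fraction A} -> K} S
  (GRing.isZmodMorphism.Build _ _ S SB) (GRing.isMonoidMorphism.Build _ _ S SM)).
Qed.

End FractionField.

(** * Substitutions that undo themselves *)

Section SelfInverseSubstitution.
Variables (A : comNzRingType) (L : fieldType) (iota sub : {rmorphism A -> L}).
Implicit Types p q w : A.

(** When [iota] embeds [A] in its field of fractions, the condition says that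
    [sub p] is a fraction [N / w] on whose numerator and denominator [sub] can be
    evaluated, with quotient [sub N / sub w] equal to [p].  In other words
    [sub (sub p) = p], in a form that makes sense before [sub] is known to extend
    to fractions. *)
Definition selfinv p : Prop := exists N w,
  [/\ sub w != 0, sub p * iota w = iota N & sub N = iota p * sub w].

Lemma selfinv_fixed p : sub p = iota p -> selfinv p.
Proof. by exists p, 1; rewrite !rmorph1 !mulr1 oner_neq0. Qed.

Lemma selfinvD p q :
  selfinv p -> selfinv q -> selfinv (p + q).
Proof.
move=> [N [w [w0 E E']]] [M [u [u0 G G']]].
exists (N * u + M * w), (w * u).
rewrite !(rmorphM, rmorphD) /= -E -G E' G'.
by split; [exact: mulf_neq0 | ring | ring].
Qed.

Lemma selfinvM p q :
  selfinv p -> selfinv q -> selfinv (p * q).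
Proof.
move=> [N [w [w0 E E']]] [M [u [u0 G G']]].
exists (N * M), (w * u); rewrite !rmorphM /= -E -G E' G'.
by split; [exact: mulf_neq0 | ring | ring].
Qed.

(** If [sub p = N / w] vanishes then [N = 0], hence [p = sub N / sub w = 0]: this
    is how injectivity of a substitution follows from its being self-inverse. *)
Lemma selfinv_eq0 p : (forall q, iota q = 0 -> q = 0) ->
  selfinv p -> sub p = 0 -> p = 0.
Proof.
move=> iota_inj [N [w [w0 E E']]] p0; apply: (iota_inj p).
apply: (mulIf w0); rewrite mul0r -E' (iota_inj N) ?rmorph0 //.
by rewrite -E p0 mul0r.
Qed.

End SelfInverseSubstitution.

(** * Rational functions in several variables *)

Section MPoly.
Variables (n : nat) (F : fieldType).

(** Polynomials are generated as a ring by the constants and the variables, so a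
    property stable under ring operations is to be checked on these only. *)
Lemma mpoly_gen_ind (P : {mpoly F[n]} -> Prop) :
  (forall c, P c%:MP) -> (forall i, P 'X_i) ->
  (forall p q, P p -> P q -> P (p + q)) ->
  (forall p q, P p -> P q -> P (p * q)) -> forall p, P p.
Proof.
move=> PC PX PD PM; elim/mpolyind=> [|c m p _ _ Pp].
  by rewrite -mpolyC0.
apply: (PD) => //; rewrite -mul_mpolyC; apply: (PM) => //.
rewrite mpolyXE_id; elim/big_ind: _ => // [|i _]; first by rewrite -mpolyC1.
by elim: (m i) => [|k IHk]; rewrite ?expr0 -?mpolyC1 // exprS; apply: PM.
Qed.

Section CoefDeriv.
Variable D : F -> F.
Hypothesis derD : derivation D.

Definition coef_deriv (p : {mpoly F[n]}) : {mpoly F[n]} :=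
  \sum_(m <- msupp p) D p@_m *: 'X_[m].

Lemma mcoeff_coef_deriv p m : (coef_deriv p)@_m = D p@_m.
Proof.
rewrite raddf_sum /=.
under eq_bigr do rewrite mcoeffZ mcoeffX.
have [mp|mNp] := boolP (m \in msupp p).
  rewrite (bigD1_seq m) ?msupp_uniq //= eqxx mulr1 big1 ?addr0 // => m' /negbTE.
  by move->; rewrite mulr0.
rewrite [in RHS]memN_msupp_eq0 // (derivation0 derD) big_seq big1 // => m' m'p.
by case: eqP => [mm'|]; rewrite ?mulr0 //; rewrite -mm' m'p in mNp.
Qed.

Lemma coef_derivD p q : coef_deriv (p + q) = coef_deriv p + coef_deriv q.
Proof.
by apply/mpolyP=> m; rewrite mcoeffD !mcoeff_coef_deriv mcoeffD (derivationD derD).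
Qed.

Lemma coef_deriv0 : coef_deriv 0 = 0.
Proof. by rewrite /coef_deriv msupp0 big_nil. Qed.

Lemma coef_derivZX c m : coef_deriv (c *: 'X_[m]) = D c *: 'X_[m].
Proof.
apply/mpolyP=> m'; rewrite mcoeff_coef_deriv !mcoeffZ !mcoeffX.
by case: eqP; rewrite ?mulr1 ?mulr0 // (derivation0 derD).
Qed.

(** Both sides are biadditive, which reduces the Leibniz rule to two monomials. *)
Lemma coef_derivM p q :
  coef_deriv (p * q) = coef_deriv p * q + p * coef_deriv q.
Proof.
elim/mpolyind: p => [|c m p _ _ IHp]; first by rewrite !(mul0r, coef_deriv0) add0r.
rewrite coef_derivD !mulrDl coef_derivD {}IHp addrACA; congr (_ + _).
elim/mpolyind: q => [|c' m' q _ _ IHq]; first by rewrite !(mulr0, coef_deriv0) add0r.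
rewrite coef_derivD !mulrDr coef_derivD {}IHq addrACA; congr (_ + _).
rewrite -scalerAl -scalerAr scalerA -mpolyXD !coef_derivZX (derivationM derD).
by rewrite scalerDl -!scalerAl -!scalerAr !scalerA -mpolyXD.
Qed.

Lemma coef_derivC c : coef_deriv c%:MP = (D c)%:MP.
Proof. by rewrite -!alg_mpolyC -mpolyX0 coef_derivZX. Qed.

Lemma coef_derivX i : coef_deriv 'X_i = 0.
Proof. by rewrite -['X_i]scale1r coef_derivZX (derivation1 derD) scale0r. Qed.

Variable v : 'I_n -> {fraction {mpoly F[n]}}.

(** The chain rule: the derivation extending [D] on the constants and taking the
    values [v] on the variables. *)
Definition vfield (p : {mpoly F[n]}) : {fraction {mpoly F[n]}} :=
  (coef_deriv p)%:F + \sum_(k < n) (p^`M(k))%:F * v k.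

Lemma vfieldD p q : vfield (p + q) = vfield p + vfield q.
Proof.
rewrite /vfield coef_derivD rmorphD addrACA -big_split; congr (_ + _).
by apply: eq_bigr => k _; rewrite mderivD rmorphD mulrDl.
Qed.

Lemma vfieldM p q : vfield (p * q) = vfield p * q%:F + p%:F * vfield q.
Proof.
rewrite /vfield coef_derivM rmorphD !rmorphM mulrDl mulrDr addrACA.
rewrite mulr_suml mulr_sumr -big_split; congr (_ + _).
apply: eq_bigr => k _; rewrite mderivM rmorphD !rmorphM mulrDl.
by rewrite mulrAC mulrA.
Qed.

Lemma vfieldC c : vfield c%:MP = ((D c)%:MP)%:F.
Proof.
rewrite /vfield coef_derivC big1 ?addr0 // => k _.
by rewrite mderivC rmorph0 mul0r.
Qed.

Lemma vfieldX i : vfield 'X_i = v i.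
Proof.
rewrite /vfield coef_derivX rmorph0 add0r (bigD1 i) //= big1 => [|k ki].
  have -> : ('X_i : {mpoly F[n]})^`M(i) = 1.
    rewrite mderivX mnm1E eqxx scale1r -mpolyX0; congr 'X_[_].
    by apply/mnmP=> j; rewrite mnmBE subnn mnm0E.
  by rewrite rmorph1 mul1r addr0.
by rewrite mderivX mnm1E eq_sym (negbTE ki) scale0r rmorph0 mul0r.
Qed.

End CoefDeriv.

Section Involution.
Variable v : 'I_n -> {fraction {mpoly F[n]}}.

Definition subst : {rmorphism {mpoly F[n]} -> {fraction {mpoly F[n]}}} :=
  mmap (@FracField.tofrac _ \o @mpolyC n F) v.

Lemma substC c : subst c%:MP = (c%:MP)%:F.
Proof. by rewrite [LHS]mmapC. Qed.

Lemma substX i : subst 'X_i = v i.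
Proof. by rewrite [LHS]mmapX mmap1U. Qed.

Hypothesis v_selfinv :
  forall i, selfinv (@FracField.tofrac {mpoly F[n]}) subst 'X_i.

Lemma subst_selfinv p :
  selfinv (@FracField.tofrac {mpoly F[n]}) subst p.
Proof.
elim/mpoly_gen_ind: p => [c|i|p q|p q].
- exact/selfinv_fixed/substC.
- exact: v_selfinv.
- exact: selfinvD.
exact: selfinvM.
Qed.

Lemma subst_inj p : subst p = 0 -> p = 0.
Proof.
apply: selfinv_eq0 (subst_selfinv p) => q /eqP.
by rewrite tofrac_eq0 => /eqP.
Qed.

(** A substitution that undoes itself on the variables extends to an involutive
    automorphism of the field of rational functions: it is injective on
    polynomials by [selfinv_eq0], and the extension [S] satisfies
    [S (N / w) = sub N / sub w], so [S (sub p) = p]. *)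
Lemma involution_ext :
  exists S : {rmorphism {fraction {mpoly F[n]}} -> {fraction {mpoly F[n]}}},
    [/\ forall c, S (c%:MP)%:F = (c%:MP)%:F,
        forall i, S ('X_i)%:F = v i & involutive S].
Proof.
have [S SE] := frac_rmorph_ext (phi := subst) subst_inj.
exists S; split=> [c|i|]; rewrite ?SE ?substC ?substX //.
elim/frac_ind=> p q q0; rewrite !fmorph_div /= !SE.
suff SK a : S (subst a) = a%:F by rewrite !SK.
have [N [w [w0 E E']]] := subst_selfinv a.
by apply: (mulIf w0); rewrite -E' -(SE N) -E rmorphM /= SE.
Qed.

End Involution.
End MPoly.

(** * Invariance of the system *)

Section Invariance.
Variable L : fieldType.
Implicit Types e be u x y z : L.

Lemma a22_normalizedE be0 be1 :
  (be1 + be1 + 2 * be0 + be1 + be1 = 1) <-> (2 * be0 + 4 * be1 = 1).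
Proof.
by have -> : be1 + be1 + 2 * be0 + be1 + be1 = 2 * be0 + 4 * be1 by ring.
Qed.

(** The normalization of the parameters forces the characteristic not to be 2,
    so that each parameter can be eliminated in favour of the other. *)
Lemma a22_two_neq0 be0 be1 : 2 * be0 + 4 * be1 = 1 -> 2 != 0 :> L.
Proof.
move=> norm; apply: contraTneq (oner_neq0 L) => two0; rewrite negbK.
have -> : 1 = 2 * (be0 + 2 * be1) :> L by rewrite -[LHS]norm; ring.
by rewrite two0 mul0r.
Qed.

Lemma four_neq0 : 2 != 0 :> L -> 4 != 0 :> L.
Proof.
move=> two0; have -> : 4 = 2 * 2 :> L by ring.
exact: mulf_neq0.
Qed.

Lemma a22_beta1E be0 be1 : 2 * be0 + 4 * be1 = 1 -> be1 = (1 - 2 * be0) / 4.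
Proof.
move=> norm; rewrite -[X in X - _]norm; field.
exact/four_neq0/(a22_two_neq0 norm).
Qed.

Lemma a22_beta0E be0 be1 : 2 * be0 + 4 * be1 = 1 -> be0 = (1 - 4 * be1) / 2.
Proof.
move=> norm; rewrite -[X in X - _]norm; field.
exact: a22_two_neq0 norm.
Qed.

(** The shift by [u = be0 / z] adds [- u R / z] to [k x'] and [k y'];
    the equations for [x] and [y] are multiplied by [z], and [be0] is eliminated
    as [u * z], which makes the identities for [s0] polynomial in [u], [x], [y],
    [z] and [e]. *)
Lemma d4P_shift e be0 be1 u x y z : be0 = u * z -> 2 * be0 + 4 * be1 = 1 ->
  let g := be1 + be0 in
  d4P e g g (- be0) g g (x + u) (y + u) z * z
  = d4P e be1 be1 be0 be1 be1 x y z * z - u * d4R e be1 be1 be0 be1 be1 x y z.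
Proof.
move=> be0E norm; have/four_neq0 two0 := a22_two_neq0 norm.
rewrite (a22_beta1E norm) be0E /= /d4P /d4R; field; exact: two0.
Qed.

Lemma d4Q_shift e be0 be1 u x y z : be0 = u * z -> 2 * be0 + 4 * be1 = 1 ->
  let g := be1 + be0 in
  d4Q e g g (- be0) g g (x + u) (y + u) z * z
  = d4Q e be1 be1 be0 be1 be1 x y z * z + u * d4R e be1 be1 be0 be1 be1 x y z.
Proof.
move=> be0E norm; have/four_neq0 two0 := a22_two_neq0 norm.
rewrite (a22_beta1E norm) be0E /= /d4Q /d4R; field; exact: two0.
Qed.

Lemma d4R_shift e be0 be1 u x y z : be0 = u * z -> 2 * be0 + 4 * be1 = 1 ->
  let g := be1 + be0 in
  d4R e g g (- be0) g g (x + u) (y + u) z = d4R e be1 be1 be0 be1 be1 x y z.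
Proof.
move=> be0E norm; have/four_neq0 two0 := a22_two_neq0 norm.
rewrite (a22_beta1E norm) be0E /= /d4R; field; exact: two0.
Qed.

(** The sum [1/x + 1/(x - e) + 1/y + 1/(y - 1)], over its common denominator as it
    appears in [s1]; see [logsumE]. *)
Definition logsum e x y : L :=
  (y * (x - e) * (y - 1) + x * (x - e) * (y - 1)
     + x * y * (y - 1) + x * y * (x - e)) / (x * y * (x - e) * (y - 1)).

(** [P] and [Q] depend on [z] through one term, divisible by the denominator of
    [logsum]; translating [z] thus adds a polynomial multiple of [be1], which the
    change of parameters cancels. *)
Lemma d4PQ_shear e be0 be1 x y z :
  x != 0 -> y != 0 -> x - e != 0 -> y - 1 != 0 -> 2 * be0 + 4 * be1 = 1 ->
  let g := - be1 in let z' := z - be1 * logsum e x y in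
  d4P e g g (be0 + 4 * be1) g g x y z' = d4P e be1 be1 be0 be1 be1 x y z /\
  d4Q e g g (be0 + 4 * be1) g g x y z' = d4Q e be1 be1 be0 be1 be1 x y z.
Proof.
move=> x0 y0 xe y1 norm; have two0 := a22_two_neq0 norm.
rewrite (a22_beta0E norm) /= /d4P /d4Q /logsum.
by split; field; rewrite x0 y0 xe y1 two0.
Qed.

(** Since [P = k x'] and [Q = - k y'], the second term on the right-hand side is
    [k] times the derivative of [- be1 * logsum e x y]. *)
Lemma d4R_shear e be0 be1 x y z :
  x != 0 -> y != 0 -> x - e != 0 -> y - 1 != 0 -> 2 * be0 + 4 * be1 = 1 ->
  let g := - be1 in
  d4R e g g (be0 + 4 * be1) g g x y (z - be1 * logsum e x y)
  = d4R e be1 be1 be0 be1 be1 x y z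
    + be1 * (d4P e be1 be1 be0 be1 be1 x y z * (x ^- 2 + (x - e) ^- 2)
             - d4Q e be1 be1 be0 be1 be1 x y z * (y ^- 2 + (y - 1) ^- 2)).
Proof.
move=> x0 y0 xe y1 norm; have two0 := a22_two_neq0 norm.
rewrite (a22_beta0E norm) /= /d4P /d4Q /d4R /logsum.
by field; rewrite x0 y0 xe y1 two0.
Qed.

Lemma logsumE e x y : x != 0 -> y != 0 -> x - e != 0 -> y - 1 != 0 ->
  logsum e x y = x^-1 + (x - e)^-1 + (y^-1 + (y - 1)^-1).
Proof. by move=> x0 y0 xe y1; rewrite /logsum; field; rewrite x0 y0 xe y1. Qed.

Variable D : L -> L.
Hypothesis derD : derivation D.

Lemma deriv_logsum e x y : D e = 0 ->
    x != 0 -> y != 0 -> x - e != 0 -> y - 1 != 0 ->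
  D (logsum e x y)
  = - (D x * (x ^- 2 + (x - e) ^- 2) + D y * (y ^- 2 + (y - 1) ^- 2)).
Proof.
move=> De x0 y0 xe y1; rewrite logsumE // !(derivationD derD) !(derivationV derD) //.
by rewrite !(derivationB derD) De (derivation1 derD) !subr0; ring.
Qed.

Variables e b be0 be1 x y z : L.
Hypotheses (De : D e = 0) (Dbe0 : D be0 = 0) (Dbe1 : D be1 = 0).
Let p : point L := (x, y, z, (be0, be1)).
Hypothesis sol : a22_system D e b p.

Lemma a22_system_s0 : z != 0 -> a22_system D e b (a22_s0 p).
Proof.
case: sol => /a22_normalizedE norm [Ex Ey Ez] z0.
split; first by apply/a22_normalizedE; rewrite -[RHS]norm; ring.
(* The shift identities are used with [u = be0 / z]. *)
have uE : be0 = be0 / z * z by rewrite divfK.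
set k := 2 * e / b in Ex Ey Ez *.
have du : k * D (be0 / z) = - (be0 / z * d4R e be1 be1 be0 be1 be1 x y z / z).
  by rewrite (derivation_div derD) // Dbe0 -Ez; field; rewrite z0.
split; last by rewrite d4R_shift.
  apply: (mulIf z0); rewrite d4P_shift // (derivationD derD) mulrDr Ex du.
  by field; rewrite z0.
apply: (mulIf z0); rewrite d4Q_shift // (derivationD derD) mulrDr Ey mulNr du.
by field; rewrite z0.
Qed.

Lemma a22_system_s1 :
  x * y * (x - e) * (y - 1) != 0 -> a22_system D e b (a22_s1 e p).
Proof.
case: sol => /a22_normalizedE norm [Ex Ey Ez].
rewrite !mulf_eq0 !negb_or => /andP[/andP[/andP[x0 y0] xe] y1].
have z'E : z - be1 * (y * (x - e) * (y - 1) + x * (x - e) * (y - 1)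
    + x * y * (y - 1) + x * y * (x - e)) / (x * y * (x - e) * (y - 1))
    = z - be1 * logsum e x y by rewrite /logsum mulrA.
split; first by apply/a22_normalizedE; rewrite -[RHS]norm; ring.
have [EP EQ] := d4PQ_shear z x0 y0 xe y1 norm.
rewrite z'E EP EQ; split=> //; rewrite d4R_shear // -Ex -Ey -Ez.
rewrite (derivationB derD) (derivationM derD) Dbe1 (deriv_logsum De) //.
ring.
Qed.

End Invariance.

(** * Two reflections of a line without common fixed point *)

Section InfiniteDihedral.
Variables (K : fieldType) (s0 s1 : {rmorphism K -> K}) (be : K).
Hypothesis char0 : forall n, n.+1%:R != 0 :> K.
Hypotheses (be0 : be != 0) (s0be : s0 be = 1 / 2 - be) (s1be : s1 be = - be).

(** Each letter reverses the sign of [be], and each occurrence of [s0] also adds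
    [1/2], up to a sign given by the parity of the number of letters applied
    before it.  In an alternating word the occurrences of [s0] are two letters
    apart, so their signs agree and the constants add up. *)
Lemma alternating_word_action c w :
  path (fun c c' : bool => c != c') c w ->
  word_action s0 s1 (c :: w) be
  = (-1) ^+ (size w).+1 * be
    + (-1) ^+ (size w + c) * ((count negb (c :: w))%:R / 2).
Proof.
elim: w c => [|c' w IHw] c /=.
  by case: c => _ /=; rewrite ?s0be ?s1be /=; field; apply: (char0 1).
case/andP=> cc' /IHw; rewrite /word_action /= => ->.
have -> : c' = ~~ c by case: (c) (c') cc' => [] [].
case: c {cc'} => /=; rewrite !(rmorphD, rmorphM, rmorph_sign, rmorph_nat, fmorphV) /=
   ?s0be ?s1be ?addn0 ?addn1 ?add0n ?add1n !exprS ?natrD; field; exact: (char0 1).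
Qed.

Lemma alternating_word_neq1 w : w <> [::] ->
  sorted (fun c c' : bool => c != c') w -> ~ (word_action s0 s1 w =1 id).
Proof.
case: w => [//|c w] _ altw /(_ be); rewrite alternating_word_action // [id be]/=.
(* A word of odd length acts as a reflection [be |-> q - be]; one of even length
   as a translation by half the number of occurrences of [s0], up to sign. *)
have [oddw|evenw] := boolP (odd (size w)); last first.
  rewrite -signr_odd /= (negbTE evenw) expr1 mulN1r; set q := _ * (_ / _) => E.
  (* [be = q - be] is impossible because [s1] fixes [q] and negates [be]: it
     would give both [2 be = q] and [- 2 be = q]. *)
  have sq : s1 q = q.
    by rewrite /q !(rmorphM, rmorph_sign, rmorph_nat, fmorphV) /=.
  have : s1 (- be + q) = s1 be by rewrite E.
  rewrite rmorphD rmorphN s1be sq /= => E'.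
  have /eqP : 2 * 2 * be = 0.
    transitivity (be - (- be) - ((- be + q) - (- - be + q))); last by rewrite E E' subrr.
    ring.
  by rewrite !mulf_eq0 (negbTE (char0 1)) (negbTE be0).
rewrite -signr_odd /= oddw expr0 mul1r => /(canRL (addKr be)); rewrite addNr => /eqP.
rewrite !mulf_eq0 invr_eq0 (negbTE (char0 1)) signr_eq0 orbF /=.
(* An alternating word of two letters or more contains [s0]. *)
case: w altw oddw => [//|c' w] /= /andP[cc' _] _.
by case: c c' cc' => [] [] // _ /=; rewrite ?add0n ?add1n (negbTE (char0 _)).
Qed.

Lemma weylA22_of_reflections : involutive s0 -> involutive s1 -> weylA22 s0 s1.
Proof. by move=> s0K s1K; split=> //; exact: alternating_word_neq1. Qed.

End InfiniteDihedral.

(** * The generators as substitutions *)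

Section GeneratorSubstitutions.
Variable L : fieldType.
Hypothesis two0 : 2 != 0 :> L.
Implicit Types e be x y z : L.

Lemma generic_normalized be :
  be + be + 2 * (1 / 2 - 2 * be) + be + be = 1.
Proof. by field. Qed.

Lemma beta0_s0E be : 1 / 2 - 2 * (be + (1 / 2 - 2 * be)) = - (1 / 2 - 2 * be).
Proof. by field. Qed.

Lemma beta0_s1E be : 1 / 2 - 2 * (- be) = 1 / 2 - 2 * be + 4 * be.
Proof. by field. Qed.

Lemma beta1_s0E be : be + (1 / 2 - 2 * be) = 1 / 2 - be.
Proof. by ring. Qed.

Variables (A : comNzRingType) (iota sub : {rmorphism A -> L}).
Implicit Types X Y Z B E : A.

(** Applied twice, the shift of [X] by [beta0 / Z] cancels because [beta0] changes
    sign.  Here [beta0 = 1/2 - 2 B], whence the factor 2 in the denominator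
    [2 Z] of [sub X]. *)
Lemma selfinv_shift X Z B :
    sub X = iota X + (1 / 2 - 2 * iota B) / iota Z -> sub Z = iota Z ->
    sub B = iota B + (1 / 2 - 2 * iota B) -> iota Z != 0 ->
  selfinv iota sub X.
Proof.
move=> subX subZ subB Z0; exists (2 * X * Z + 1 - 4 * B), (2 * Z).
rewrite !(rmorphB, rmorphD, rmorphM, rmorph_nat, rmorph1) /= subX subZ subB.
by split; [exact: mulf_neq0 | field | field]; rewrite ?two0 ?Z0.
Qed.

Lemma selfinv_reflection B :
  sub B = iota B + (1 / 2 - 2 * iota B) -> selfinv iota sub B.
Proof.
move=> subB; exists (1 - 2 * B), 2.
rewrite !(rmorphB, rmorphM, rmorph_nat, rmorph1) /= subB.
by split=> //; field.
Qed.

Lemma selfinv_opp B : sub B = - iota B -> selfinv iota sub B.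
Proof.
move=> subB; exists (- B), 1; rewrite !rmorph1 !mulr1 !rmorphN subB opprK.
by split=> //; exact: oner_neq0.
Qed.

(** [sub] fixes [X], [Y] and [E], and negates [B], so the second translation of
    [Z] is opposite to the first. *)
Lemma selfinv_shear E X Y Z B :
    let w := iota X * iota Y * (iota X - iota E) * (iota Y - 1) in
    sub X = iota X -> sub Y = iota Y -> sub E = iota E -> sub B = - iota B ->
    sub Z = iota Z - iota B
      * (iota Y * (iota X - iota E) * (iota Y - 1)
         + iota X * (iota X - iota E) * (iota Y - 1)
         + iota X * iota Y * (iota Y - 1)
         + iota X * iota Y * (iota X - iota E)) / w ->
    w != 0 -> selfinv iota sub Z.
Proof.
move=> /= subX subY subE subB subZ w0.
exists (Z * (X * Y * (X - E) * (Y - 1))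
        - B * (Y * (X - E) * (Y - 1) + X * (X - E) * (Y - 1)
               + X * Y * (Y - 1) + X * Y * (X - E))),
       (X * Y * (X - E) * (Y - 1)).
rewrite !(rmorphB, rmorphD, rmorphM, rmorph1) /= subZ subX subY subE subB.
move: w0; rewrite !mulf_eq0 !negb_or => /andP[/andP[/andP[x0 y0] xe] y1].
by split; [rewrite ?x0 ?y0 ?xe | field | field]; rewrite ?x0 ?y0 ?xe ?y1.
Qed.

End GeneratorSubstitutions.

(** * The function field and its automorphisms *)

Section A22FunctionField.
Variables (R : realType) (eta : R[i]) (b : ratfun R).

Lemma ddt_derivation : derivation (@ddt R).
Proof.
apply: frac_deriv_derivation => p q; first by rewrite derivD rmorphD.
by rewrite derivM rmorphD !rmorphM.
Qed.

Lemma ddt_cst (c : R[i]) : ddt (cst c) = 0.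
Proof.
rewrite /ddt /cst frac_deriv_tofrac => [|p q]; first by rewrite derivC rmorph0.
by rewrite derivM rmorphD !rmorphM.
Qed.

Lemma a22_deriv_derivation : derivation (a22_deriv eta b).
Proof.
apply: frac_deriv_derivation => p q; first exact: vfieldD ddt_derivation _ _ _.
exact: vfieldM ddt_derivation _ _ _.
Qed.

Lemma a22_deriv_tofrac p :
  a22_deriv eta b p%:F = vfield (@ddt R) (a22_velocity eta b) p.
Proof. apply: frac_deriv_tofrac => p' q; exact: vfieldM ddt_derivation _ _ _. Qed.

Lemma a22_deriv_cst c : a22_deriv eta b (emb (cst c)) = 0.
Proof.
rewrite /emb a22_deriv_tofrac (vfieldC ddt_derivation) ddt_cst.
by rewrite mpolyC0 rmorph0.
Qed.

Lemma a22_deriv_coord k : a22_deriv eta b (Defs.coord R k) = a22_velocity eta b k.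
Proof. by rewrite /Defs.coord a22_deriv_tofrac (vfieldX ddt_derivation). Qed.

Lemma Kfield_char0 n : n.+1%:R != 0 :> Kfield R.
Proof.
rewrite -(rmorph_nat (@FracField.tofrac {mpoly (ratfun R)[4]})) tofrac_eq0.
rewrite -(rmorph_nat (@mpolyC 4 (ratfun R))) mpolyC_eq0.
rewrite -(rmorph_nat (@FracField.tofrac {poly R[i]})) tofrac_eq0.
by rewrite -(rmorph_nat (@polyC R[i])) polyC_eq0 Num.Theory.pnatr_eq0.
Qed.

(** [X_k - c] has coefficient 1 at [X_k].  With [c] equal to 0, 1 and [eta], this
    provides the denominators of [s0] and [s1]. *)
Lemma coord_subC_neq0 k (c : ratfun R) : Defs.coord R k - emb c != 0.
Proof.
rewrite /Defs.coord /emb -rmorphB tofrac_eq0.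
apply: contra_neq (oner_neq0 (ratfun R)) => /(congr1 (mcoeff U_(k))).
rewrite mcoeffB mcoeffXU mcoeffC mcoeff0 eqxx.
have -> : (U_(k) == 0 :> 'X_{1..4})%MM = false.
  by apply/negbTE/eqP=> /mnmP/(_ k); rewrite mnm1E eqxx mnm0E.
by rewrite mulr0 subr0.
Qed.

Lemma emb0 : emb (0 : ratfun R) = 0.
Proof. by rewrite /emb mpolyC0 rmorph0. Qed.

Lemma emb1 : emb (1 : ratfun R) = 1.
Proof. by rewrite /emb mpolyC1 rmorph1. Qed.

Lemma coord_neq0 k : Defs.coord R k != 0.
Proof. by rewrite -[Defs.coord R k]subr0 -emb0 coord_subC_neq0. Qed.

Lemma coord_sub1_neq0 k : Defs.coord R k - 1 != 0.
Proof. by rewrite -emb1 coord_subC_neq0. Qed.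

Lemma emb_eq0 (c : ratfun R) : (emb c == 0) = (c == 0).
Proof. by rewrite /emb tofrac_eq0 mpolyC_eq0. Qed.

Hypotheses (heta : eta != 0) (hb : b != 0).

Lemma emb_cst_neq0 : emb (cst eta) != 0.
Proof. by rewrite emb_eq0 /cst tofrac_eq0 polyC_eq0. Qed.

(** The velocities defining [a22_deriv] are the right-hand sides of the system
    divided by [2 eta / b], which is possible as [eta] and [b] do not vanish. *)
Lemma generic_solution :
  a22_system (a22_deriv eta b) (emb (cst eta)) (emb b) (generic_point R).
Proof.
have two0 := Kfield_char0 1; have e0 := emb_cst_neq0.
have b0 : emb b != 0 by rewrite emb_eq0.
have cK (L : fieldType) (e c f : L) : 2 != 0 :> L -> e != 0 -> c != 0 ->
    (2 * e / c * (c / (2 * e) * f) = f) * (- (2 * e / c) * (- (c / (2 * e)) * f) = f).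
  by move=> n0 m0 l0; split; field; rewrite n0 m0 l0.
split; last first.
  rewrite /gx /gy /gz !a22_deriv_coord /a22_velocity /=.
  by split; rewrite ?cK.
exact: generic_normalized two0 _.
Qed.

Lemma a22_deriv_gbe1 : a22_deriv eta b (gbe1 R) = 0.
Proof. by rewrite /gbe1 a22_deriv_coord. Qed.

Lemma derivation_half_sub (L : fieldType) (D : L -> L) (be : L) :
  derivation D -> 2 != 0 :> L -> D be = 0 -> D (1 / 2 - 2 * be) = 0.
Proof.
move=> derD two0 Dbe; rewrite (derivationB derD) (derivation_div derD) //.
by rewrite (derivationM derD) Dbe (derivation_nat derD) (derivation1 derD); ring.
Qed.

Lemma a22_deriv_gbe0 : a22_deriv eta b (gbe0 R) = 0.
Proof.
exact: (derivation_half_sub a22_deriv_derivation (Kfield_char0 1) a22_deriv_gbe1).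
Qed.

Definition a22_s0_coords (k : 'I_4) : Kfield R :=
  nth 0 [:: gx R + gbe0 R / gz R; gy R + gbe0 R / gz R; gz R;
            gbe1 R + gbe0 R] k.

Definition a22_s1_coords (k : 'I_4) : Kfield R :=
  nth 0 [:: gx R; gy R;
            (a22_s1 (emb (cst eta)) (generic_point R)).1.2; - gbe1 R] k.

Local Notation X0 := ('X_(@Ordinal 4 0 isT) : {mpoly (ratfun R)[4]}).
Local Notation X1 := ('X_(@Ordinal 4 1 isT) : {mpoly (ratfun R)[4]}).
Local Notation X2 := ('X_(@Ordinal 4 2 isT) : {mpoly (ratfun R)[4]}).
Local Notation X3 := ('X_(@Ordinal 4 3 isT) : {mpoly (ratfun R)[4]}).

Lemma ord4_ind (P : 'I_4 -> Prop) :
  P (@Ordinal 4 0 isT) -> P (@Ordinal 4 1 isT) -> P (@Ordinal 4 2 isT) ->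
  P (@Ordinal 4 3 isT) -> forall k, P k.
Proof.
move=> P0 P1 P2 P3 [[|[|[|[|//]]]] lt4];
  by rewrite (bool_irrelevance lt4 isT).
Qed.

Lemma a22_s0_exists : exists S : {rmorphism Kfield R -> Kfield R},
  [/\ forall f, S (emb f) = emb f, involutive S
    & map_point S (generic_point R) = a22_s0 (generic_point R)].
Proof.
have two0 := Kfield_char0 1; have z0 := coord_neq0 (@Ordinal 4 2 isT).
case: (involution_ext (v := a22_s0_coords)) => [|S [SC SX SK]]; last first.
  exists S; split=> //.
  have S0 := SX (@Ordinal 4 0 isT); have S1 := SX (@Ordinal 4 1 isT).
  have S2 := SX (@Ordinal 4 2 isT); have S3 := SX (@Ordinal 4 3 isT).
  rewrite /map_point /generic_point /a22_s0 S0 S1 S2 S3.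
  have -> : S (gbe0 R) = - gbe0 R.
    rewrite {1}/gbe0 !(rmorphB, rmorphM, fmorphV, rmorph_nat, rmorph1) /=.
    by rewrite S3; exact: beta0_s0E two0 _.
  by [].
elim/ord4_ind.
- by apply: (selfinv_shift two0 (Z := X2) (B := X3)) z0; exact: substX.
- by apply: (selfinv_shift two0 (Z := X2) (B := X3)) z0; exact: substX.
- exact/selfinv_fixed/substX.
exact/(selfinv_reflection two0)/substX.
Qed.

Lemma a22_s1_exists : exists S : {rmorphism Kfield R -> Kfield R},
  [/\ forall f, S (emb f) = emb f, involutive S
    & map_point S (generic_point R)
      = a22_s1 (emb (cst eta)) (generic_point R)].
Proof.
have two0 := Kfield_char0 1.
have x0 : gx R != 0 := coord_neq0 _; have y0 : gy R != 0 := coord_neq0 _.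
have xe : gx R - emb (cst eta) != 0 := coord_subC_neq0 _ _.
have y1 : gy R - 1 != 0 := coord_sub1_neq0 _.
have w0 := mulf_neq0 (mulf_neq0 (mulf_neq0 x0 y0) xe) y1.
case: (involution_ext (v := a22_s1_coords)) => [|S [SC SX SK]]; last first.
  exists S; split=> //.
  have S0 := SX (@Ordinal 4 0 isT); have S1 := SX (@Ordinal 4 1 isT).
  have S2 := SX (@Ordinal 4 2 isT); have S3 := SX (@Ordinal 4 3 isT).
  rewrite /map_point /generic_point /a22_s1 S0 S1 S2 S3.
  have -> : S (gbe0 R) = gbe0 R + 4 * gbe1 R.
    rewrite {1}/gbe0 !(rmorphB, rmorphM, fmorphV, rmorph_nat, rmorph1) /=.
    by rewrite S3; exact: beta0_s1E two0 _.
  by [].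
elim/ord4_ind.
- exact/selfinv_fixed/substX.
- exact/selfinv_fixed/substX.
- apply: (selfinv_shear (E := (cst eta)%:MP) (X := X0) (Y := X1) (B := X3))
    w0; first [exact: substX | exact: substC].
exact/selfinv_opp/substX.
Qed.

Lemma backlund_of_solution (S : {rmorphism Kfield R -> Kfield R}) x y z be0 be1 :
    (forall f, S (emb f) = emb f) -> involutive S ->
    map_point S (generic_point R) = (x, y, z, (be0, be1)) ->
    a22_deriv eta b be0 = 0 -> a22_deriv eta b be1 = 0 ->
    a22_system (a22_deriv eta b) (emb (cst eta)) (emb b) (x, y, z, (be0, be1)) ->
  backlund eta b S.
Proof.
move=> SC SK SE D0 D1 sol; split.
- by exists S.
- exact: SC.
- have [/(congr1 (a22_deriv eta b)) E0 /(congr1 (a22_deriv eta b)) E1] :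
      S (gbe0 R) = be0 /\ S (gbe1 R) = be1.
    exact: (conj (congr1 (fun p => p.2.1) SE) (congr1 (fun p => p.2.2) SE)).
  exact: conj (etrans E0 D0) (etrans E1 D1).
by rewrite SE.
Qed.

Lemma a22_s0_backlund (S : {rmorphism Kfield R -> Kfield R}) :
  (forall f, S (emb f) = emb f) -> involutive S ->
  map_point S (generic_point R) = a22_s0 (generic_point R) -> backlund eta b S.
Proof.
have derD := a22_deriv_derivation.
move=> SC SK SE; apply: (backlund_of_solution SC SK SE).
- by rewrite (derivationN derD) a22_deriv_gbe0 oppr0.
- by rewrite (derivationD derD) a22_deriv_gbe0 a22_deriv_gbe1 addr0.
apply: (a22_system_s0 derD (a22_deriv_gbe0) generic_solution).
exact: coord_neq0.
Qed.

Lemma a22_s1_backlund (S : {rmorphism Kfield R -> Kfield R}) :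
  (forall f, S (emb f) = emb f) -> involutive S ->
  map_point S (generic_point R) = a22_s1 (emb (cst eta)) (generic_point R) ->
  backlund eta b S.
Proof.
have derD := a22_deriv_derivation.
move=> SC SK SE; apply: (backlund_of_solution SC SK SE).
- rewrite (derivationD derD) (derivationM derD) (derivation_nat derD).
  by rewrite a22_deriv_gbe0 a22_deriv_gbe1 mul0r mulr0 !addr0.
- by rewrite (derivationN derD) a22_deriv_gbe1 oppr0.
apply: (a22_system_s1 derD (a22_deriv_cst eta) a22_deriv_gbe1 generic_solution).
apply: mulf_neq0 (coord_sub1_neq0 _); apply: mulf_neq0 (coord_subC_neq0 _ _).
exact: mulf_neq0 (coord_neq0 _) (coord_neq0 _).
Qed.

End A22FunctionField.

Theorem theorem7p1 (R : realType) (eta : R[i]) (b : ratfun R)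
    (heta : eta != 0) (hb : b != 0) :
  (exists s0 s1 : {rmorphism Kfield R -> Kfield R},
     [/\ map_point s0 (generic_point R) = a22_s0 (generic_point R),
         map_point s1 (generic_point R)
           = a22_s1 (emb (cst eta)) (generic_point R),
         backlund eta b s0, backlund eta b s1
       & weylA22 s0 s1])
  /\
  (* the same transformations at given complex parameters, on solutions in an
     arbitrary differential field extension of C(t) *)
  (forall (L : fieldType) (D : L -> L) (iota : {rmorphism ratfun R -> L}),
     derivation D -> (forall f, D (iota f) = iota (ddt f)) ->
   forall (be0 be1 : R[i]) (x y z : L),
     let e := iota (cst eta) in
     let p := (x, y, z, (iota (cst be0), iota (cst be1))) in
     a22_system D e (iota b) p ->
     (z != 0 -> a22_system D e (iota b) (a22_s0 p)) /\
     (x * y * (x - e) * (y - 1) != 0 ->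
        a22_system D e (iota b) (a22_s1 e p))).
Proof.
split.
  have [s0 [s0C s0K s0E]] := a22_s0_exists R.
  have [s1 [s1C s1K s1E]] := a22_s1_exists eta.
  exists s0, s1; split.
  - exact: s0E.
  - exact: s1E.
  - exact: a22_s0_backlund.
  - exact: a22_s1_backlund.
  have s0be : s0 (gbe1 R) = 1 / 2 - gbe1 R.
    exact: etrans (congr1 (fun p => p.2.2) s0E) (beta1_s0E _).
  have s1be : s1 (gbe1 R) = - gbe1 R := congr1 (fun p => p.2.2) s1E.
  exact: (weylA22_of_reflections (@Kfield_char0 R) (coord_neq0 _ _) s0be s1be s0K s1K).
move=> L D iota derD Diota be0 be1 x y z e p sol.
have Dcst c : D (iota (cst c)) = 0 by rewrite Diota ddt_cst rmorph0.
by split=> h; [apply: (a22_system_s0 derD (Dcst _) sol h)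
              | apply: (a22_system_s1 derD (Dcst _) (Dcst _) sol h)].
Qed.
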